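(* Let $\Omega\subset\mathbb{C}$ be an exceptional domain such that $\mathbb{C}\setminus\Omega$ is bounded, and let $u$ be its associated function. Then $|\nabla u|<1$ in $\Omega$, and $$\lim_{|z|\to\infty}\nabla u(z)=0.$$
   Context: We identify $\mathbb{R}^2$ with $\mathbb{C}$. An open set $\Omega\subset\mathbb{C}$ with non-empty boundary is a smooth domain if, for each $z_0\in\partial\Omega$, there exist $\varepsilon>0$ and a smooth diffeomorphism $\psi$ from $D(z_0,\varepsilon)$ onto an open set $D\subset\mathbb{R}^2$ such that $\psi(D(z_0,\varepsilon)\cap\Omega)=D\cap\{x_2>0\}$ and $\psi(D(z_0,\varepsilon)\cap\partial\Omega)=D\cap\{x_2=0\}$. An exceptional domain is a smooth, connected, unbounded domain $\Omega\subset\mathbb{C}$ with non-empty boundary that admits a function $u$, harmonic in $\Omega$ and $C^1$ up to the boundary, such that $u>0$ in $\Omega$, $u=0$ on $\partial\Omega$, and $|\nabla u|=1$ on $\partial\Omega$. Such a $u$ is unique, and we call it the associated function of $\Omega$. *)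

(* Defs.v *)
From Stdlib Require Import Reals.
Open Scope R_scope.

Definition R2 := (R * R)%type.

Definition norm2 (z : R2) : R := sqrt (fst z ^ 2 + snd z ^ 2).
Definition dist2 (z w : R2) : R := norm2 (fst z - fst w, snd z - snd w).

Definition disk2 (z0 : R2) (eps : R) (z : R2) : Prop := dist2 z z0 < eps.

Definition is_open2 (U : R2 -> Prop) : Prop :=
  forall z, U z -> exists eps, 0 < eps /\ forall w, disk2 z eps w -> U w.

Definition interior2 (S : R2 -> Prop) (z : R2) : Prop :=
  exists eps, 0 < eps /\ forall w, disk2 z eps w -> S w.

Definition closure2 (S : R2 -> Prop) (z : R2) : Prop :=
  forall eps, 0 < eps -> exists w, S w /\ dist2 w z < eps.

Definition boundary2 (S : R2 -> Prop) (z : R2) : Prop :=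
  closure2 S z /\ ~ interior2 S z.

Definition bounded2 (S : R2 -> Prop) : Prop :=
  exists M, forall z, S z -> norm2 z <= M.

Definition compl2 (S : R2 -> Prop) (z : R2) : Prop := ~ S z.

Definition connected_open (O : R2 -> Prop) : Prop :=
  forall A B : R2 -> Prop, is_open2 A -> is_open2 B ->
    (forall z, O z -> A z \/ B z) ->
    (forall z, O z -> A z -> B z -> False) ->
    (exists z, O z /\ A z) -> (exists z, O z /\ B z) -> False.

Definition cont_on (S : R2 -> Prop) (f : R2 -> R) : Prop :=
  forall z, S z -> forall eps, 0 < eps -> exists delta, 0 < delta /\
    forall w, S w -> dist2 w z < delta -> Rabs (f w - f z) < eps.

Definition partial_x (f : R2 -> R) (z : R2) (l : R) : Prop :=
  derivable_pt_lim (fun t => f (t, snd z)) (fst z) l.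
Definition partial_y (f : R2 -> R) (z : R2) (l : R) : Prop :=
  derivable_pt_lim (fun t => f (fst z, t)) (snd z) l.

Fixpoint Ck (k : nat) (U : R2 -> Prop) (f : R2 -> R) : Prop :=
  match k with
  | O => cont_on U f
  | S k' => cont_on U f /\
      exists fx fy : R2 -> R,
        (forall z, U z -> partial_x f z (fx z) /\ partial_y f z (fy z)) /\
        Ck k' U fx /\ Ck k' U fy
  end.

Definition smooth_on (U : R2 -> Prop) (f : R2 -> R) : Prop := forall k, Ck k U f.

Definition smooth_map_on (U : R2 -> Prop) (psi : R2 -> R2) : Prop :=
  smooth_on U (fun z => fst (psi z)) /\ smooth_on U (fun z => snd (psi z)).

Definition smooth_diffeo (U V : R2 -> Prop) (psi : R2 -> R2) : Prop :=
  smooth_map_on U psi /\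
  (forall z, U z -> V (psi z)) /\
  exists phi : R2 -> R2,
    smooth_map_on V phi /\
    (forall w, V w -> U (phi w)) /\
    (forall z, U z -> phi (psi z) = z) /\
    (forall w, V w -> psi (phi w) = w).

Definition smooth_domain (Om : R2 -> Prop) : Prop :=
  is_open2 Om /\ (exists z, boundary2 Om z) /\
  forall z0, boundary2 Om z0 ->
    exists eps (psi : R2 -> R2) (D : R2 -> Prop),
      0 < eps /\ is_open2 D /\ smooth_diffeo (disk2 z0 eps) D psi /\
      (forall w, (D w /\ snd w > 0) <->
                 exists z, disk2 z0 eps z /\ Om z /\ psi z = w) /\
      (forall w, (D w /\ snd w = 0) <->
                 exists z, disk2 z0 eps z /\ boundary2 Om z /\ psi z = w).

Definition harmonic (U : R2 -> Prop) (u : R2 -> R) : Prop :=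
  Ck 2 U u /\
  forall fx fy : R2 -> R,
    (forall z, U z -> partial_x u z (fx z) /\ partial_y u z (fy z)) ->
    forall z a b, U z -> partial_x fx z a -> partial_y fy z b -> a + b = 0.

Definition C1_up_to_boundary_with (Om : R2 -> Prop) (u gx gy : R2 -> R) : Prop :=
  Ck 1 Om u /\ cont_on (closure2 Om) u /\
  cont_on (closure2 Om) gx /\ cont_on (closure2 Om) gy /\
  (forall z, Om z -> partial_x u z (gx z) /\ partial_y u z (gy z)).

Definition associated_function (Om : R2 -> Prop) (u : R2 -> R) : Prop :=
  harmonic Om u /\
  exists gx gy : R2 -> R,
    C1_up_to_boundary_with Om u gx gy /\
    (forall z, Om z -> u z > 0) /\
    (forall z, boundary2 Om z -> u z = 0) /\
    (forall z, boundary2 Om z -> sqrt (gx z ^ 2 + gy z ^ 2) = 1).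

Definition exceptional_domain (Om : R2 -> Prop) : Prop :=
  smooth_domain Om /\ connected_open Om /\ ~ bounded2 Om /\
  exists u, associated_function Om u.

(* Main.v *)
Require Import Defs.
From Stdlib Require Import Reals Lra Psatz Classical IndefiniteDescription.
From Coquelicot Require Import Coquelicot.
Open Scope R_scope.

(** Outside a large disk [u] is positive and harmonic.  The flux of [grad u] through circles is
    constant, so the mean of [u] over [|z| = r] is [A + k ln r].  The bound [rho |grad u(c)| <= 2 u(c)]
    for positive harmonic functions on the disk [D(c, rho)] bounds the angular derivative of [ln u],
    which gives a Harnack inequality on the circles [|z| = r]; hence [u] is at most logarithmic, and
    the same gradient bound yields [grad u -> 0] at infinity.  If [|grad u| >= 1] somewhere in the
    domain, then [|grad u|] attains its maximum there, since it is 1 on the boundary and small at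
    infinity.  The derivative of [u] in the direction of the gradient at a maximum point has the mean
    value property, so by connectedness [|grad u|] is constant, contradicting its decay. *)

(* The radius may be negative: circle means are then differentiable in the radius across 0. *)
Definition polar (c : R2) (r t : R) : R2 := (fst c + r * cos t, snd c + r * sin t).

(** * Euclidean distance, open sets and continuity in the plane *)

Lemma dist2_le_abs (z w : R2) : dist2 z w <= Rabs (fst z - fst w) + Rabs (snd z - snd w).
Proof.
  unfold dist2, norm2; simpl.
  set (a := fst z - fst w); set (b := snd z - snd w).
  rewrite <- (sqrt_Rsqr (Rabs a + Rabs b)).
  - apply sqrt_le_1_alt; unfold Rsqr.
    pose proof (Rabs_pos a); pose proof (Rabs_pos b).
    assert (Rabs a * Rabs a = a * a) by (rewrite <- Rabs_mult; apply Rabs_pos_eq, Rle_0_sqr).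
    assert (Rabs b * Rabs b = b * b) by (rewrite <- Rabs_mult; apply Rabs_pos_eq, Rle_0_sqr).
    nra.
  - pose proof (Rabs_pos a); pose proof (Rabs_pos b); lra.
Qed.

(** The [ball] of the product [R * R] is a square; halving its radius makes it fit inside the
    Euclidean disk. *)
Lemma ball_dist2 (z w : R2) (d : R) : ball (z : R * R) (d / 2) (w : R * R) -> dist2 w z < d.
Proof.
  intros [H1 H2].
  assert (H1' : Rabs (fst w - fst z) < d / 2) by exact H1.
  assert (H2' : Rabs (snd w - snd z) < d / 2) by exact H2.
  pose proof (dist2_le_abs w z); lra.
Qed.

Lemma dist2_ball (z w : R2) (d : R) : dist2 w z < d -> ball (z : R * R) d (w : R * R).
Proof.
  unfold dist2, norm2; simpl; intros H.
  assert (K : forall a b, sqrt (a * (a * 1) + b * (b * 1)) < d -> Rabs a < d).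
  { intros a b Hab; eapply Rle_lt_trans; [|exact Hab].
    rewrite <- sqrt_Rsqr_abs; apply sqrt_le_1_alt; unfold Rsqr; nra. }
  split.
  - exact (K _ _ H).
  - apply (K (snd w - snd z) (fst w - fst z)); rewrite Rplus_comm; exact H.
Qed.

Lemma open_locally (U : R2 -> Prop) (z : R2) : is_open2 U -> U z -> locally (z : R * R) U.
Proof.
  intros HU Hz; destruct (HU z Hz) as [e [He H]].
  assert (He2 : 0 < e / 2) by lra.
  exists (mkposreal _ He2); intros w Hw; apply H, ball_dist2, Hw.
Qed.

(** Translation to filters, so that the limit theorems for sums and products apply to [cont_on]. *)
Lemma cont_on_filterlim (S : R2 -> Prop) (F : R2 -> R) :
  cont_on S F <->
  forall z, S z -> filterlim (F : R * R -> R) (within S (locally (z : R * R))) (locally (F z)).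
Proof.
  split.
  - intros HF z Hz; apply filterlim_locally; intros eps.
    destruct (HF z Hz eps (cond_pos eps)) as [d [Hd H]].
    assert (Hd2 : 0 < d / 2) by lra.
    exists (mkposreal _ Hd2); intros w Hw HSw.
    apply H; [exact HSw|]; apply ball_dist2, Hw.
  - intros HF z Hz eps He.
    pose proof (proj1 (filterlim_locally _ _) (HF z Hz) (mkposreal eps He)) as [d Hd].
    exists d; split; [apply cond_pos|]; intros w Hw Hwz.
    exact (Hd w (dist2_ball _ _ _ Hwz) Hw).
Qed.

Lemma cont_on_const (S : R2 -> Prop) (k : R) : cont_on S (fun _ => k).
Proof. apply cont_on_filterlim; intros z _; apply filterlim_const. Qed.

Lemma cont_on_plus (S : R2 -> Prop) (F G : R2 -> R) :
  cont_on S F -> cont_on S G -> cont_on S (fun z => F z + G z).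
Proof.
  intros HF HG; apply cont_on_filterlim; intros z Hz.
  eapply filterlim_comp_2.
  - exact (proj1 (cont_on_filterlim S F) HF z Hz).
  - exact (proj1 (cont_on_filterlim S G) HG z Hz).
  - exact (filterlim_plus (V := R_NormedModule) (F z) (G z)).
Qed.

Lemma cont_on_mult (S : R2 -> Prop) (F G : R2 -> R) :
  cont_on S F -> cont_on S G -> cont_on S (fun z => F z * G z).
Proof.
  intros HF HG; apply cont_on_filterlim; intros z Hz.
  eapply filterlim_comp_2.
  - exact (proj1 (cont_on_filterlim S F) HF z Hz).
  - exact (proj1 (cont_on_filterlim S G) HG z Hz).
  - exact (filterlim_mult (K := R_AbsRing) (F z) (G z)).
Qed.

Lemma cont_on_subset (S T : R2 -> Prop) (F : R2 -> R) :
  (forall z, S z -> T z) -> cont_on T F -> cont_on S F.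
Proof.
  intros HST HF z Hz e He; destruct (HF z (HST z Hz) e He) as [d [Hd H]].
  exists d; split; auto.
Qed.

Lemma cont_on_continuous (U : R2 -> Prop) (F : R2 -> R) (z : R2) :
  is_open2 U -> cont_on U F -> U z -> continuous (F : R * R -> R) z.
Proof.
  intros HU HF Hz P HP.
  pose proof (proj1 (cont_on_filterlim U F) HF z Hz P HP) as H.
  refine (filter_imp _ _ _ (filter_and _ _ (open_locally U z HU Hz) H)).
  intros w [Hw Hw']; exact (Hw' Hw).
Qed.

(** * Continuously differentiable functions and their derivatives in polar coordinates *)

(** The partial derivatives are arguments rather than existential witnesses as in [Ck 1], since they
    appear in integrands below. *)
Definition C1_on (U : R2 -> Prop) (F Fx Fy : R2 -> R) : Prop :=
  (forall z, U z -> partial_x F z (Fx z) /\ partial_y F z (Fy z)) /\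
  cont_on U F /\ cont_on U Fx /\ cont_on U Fy.

Lemma C1_on_comb U F Fx Fy G Gx Gy (a b : R) :
  C1_on U F Fx Fy -> C1_on U G Gx Gy ->
  C1_on U (fun z => a * F z + b * G z) (fun z => a * Fx z + b * Gx z) (fun z => a * Fy z + b * Gy z).
Proof.
  intros (HF1 & HF2 & HF3 & HF4) (HG1 & HG2 & HG3 & HG4); split; [|split; [|split]].
  - intros z Hz; destruct (HF1 z Hz) as [P1 P2]; destruct (HG1 z Hz) as [Q1 Q2]; split;
      (apply derivable_pt_lim_plus; apply derivable_pt_lim_scal; assumption).
  - now apply cont_on_plus; apply cont_on_mult; try apply cont_on_const.
  - now apply cont_on_plus; apply cont_on_mult; try apply cont_on_const.
  - now apply cont_on_plus; apply cont_on_mult; try apply cont_on_const.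
Qed.

(** Continuity of a partial derivative upgrades partial to total differentiability, which the chain
    rule along curves requires. *)
Lemma C1_on_differentiable (U : R2 -> Prop) (F Fx Fy : R2 -> R) (z : R2) :
  is_open2 U -> C1_on U F Fx Fy -> U z ->
  differentiable_pt_lim (fun x y => F (x, y)) (fst z) (snd z) (Fx z) (Fy z).
Proof.
  intros HU [HD [_ [HFx _]]] Hz.
  apply filterdiff_differentiable_pt_lim.
  destruct z as [x y]; simpl fst; simpl snd.
  apply (filterdiff_ext_lin _ (fun u : R * R => plus (scal (fst u) (Fx (x, y))) (scal (snd u) (Fy (x, y))))).
  - apply (is_derive_filterdiff (fun x y => F (x, y)) x y (fun x y => Fx (x, y)) (Fy (x, y))).
    + generalize (open_locally U _ HU Hz); apply filter_imp; intros [p q] Hp.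
      apply is_derive_Reals; apply (HD _ Hp).
    + apply is_derive_Reals; apply (HD _ Hz).
    + apply (continuous_ext (Fx : R * R -> R)); [intros [p q]; reflexivity|].
      exact (cont_on_continuous U Fx _ HU HFx Hz).
  - intros [p q]; reflexivity.
Qed.

Lemma C1_on_chain (U : R2 -> Prop) (F Fx Fy : R2 -> R) (p q : R -> R) (t p' q' : R) :
  is_open2 U -> C1_on U F Fx Fy -> U (p t, q t) ->
  is_derive p t p' -> is_derive q t q' ->
  is_derive (fun s => F (p s, q s)) t (Fx (p t, q t) * p' + Fy (p t, q t) * q').
Proof.
  intros HU HF Ht Hp Hq; apply is_derive_Reals.
  apply (derivable_pt_lim_comp_2d (fun x y => F (x, y))).
  - exact (C1_on_differentiable U F Fx Fy _ HU HF Ht).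
  - now apply is_derive_Reals.
  - now apply is_derive_Reals.
Qed.

Lemma C1_on_derive_radius U F Fx Fy c r t :
  is_open2 U -> C1_on U F Fx Fy -> U (polar c r t) ->
  is_derive (fun s => F (polar c s t)) r
    (Fx (polar c r t) * cos t + Fy (polar c r t) * sin t).
Proof.
  intros HU HF Ht; unfold polar.
  apply (C1_on_chain U F Fx Fy (fun s => fst c + s * cos t) (fun s => snd c + s * sin t)); auto;
    auto_derive; auto; ring.
Qed.

Lemma C1_on_derive_angle U F Fx Fy c r t :
  is_open2 U -> C1_on U F Fx Fy -> U (polar c r t) ->
  is_derive (fun s => F (polar c r s)) t
    (Fx (polar c r t) * (- r * sin t) + Fy (polar c r t) * (r * cos t)).
Proof.
  intros HU HF Ht; unfold polar.
  apply (C1_on_chain U F Fx Fy (fun s => fst c + r * cos s) (fun s => snd c + r * sin s)); auto;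
    auto_derive; auto; ring.
Qed.

Lemma continuous_of_derive (f : R -> R) (t l : R) : is_derive f t l -> continuous f t.
Proof. intros H; apply (ex_derive_continuous f); exists l; exact H. Qed.

Lemma continuous_cos_snd (q : R * R) : continuous (fun q : R * R => cos (snd q)) q.
Proof. apply (continuous_comp (snd : R * R -> R) cos); [destruct q; apply continuous_snd | apply continuous_cos]. Qed.

Lemma continuous_sin_snd (q : R * R) : continuous (fun q : R * R => sin (snd q)) q.
Proof. apply (continuous_comp (snd : R * R -> R) sin); [destruct q; apply continuous_snd | apply continuous_sin]. Qed.

Lemma cont_on_polar U F c r t :
  is_open2 U -> cont_on U F -> U (polar c r t) ->
  continuous (fun q : R * R => F (polar c (fst q) (snd q))) (r, t).
Proof.
  intros HU HF Ht.
  unfold polar.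
  apply (continuous_comp_2 (fun q : R * R => fst c + fst q * cos (snd q))
    (fun q : R * R => snd c + fst q * sin (snd q)) (fun x y => F (x, y))).
  1, 2: apply (continuous_plus (V := R_NormedModule)); [apply continuous_const|];
    apply (continuous_mult (K := R_AbsRing)); first [apply continuous_fst | apply continuous_cos_snd | apply continuous_sin_snd].
  apply (continuous_ext (F : R * R -> R)); [intros [x y]; reflexivity|].
  exact (cont_on_continuous U F _ HU HF Ht).
Qed.

Lemma continuous_slice (G : R -> R -> R) (r t : R) :
  continuous (fun q : R * R => G (fst q) (snd q)) (r, t) -> continuous (G r) t.
Proof.
  intros H; apply (continuous_comp_2 (fun _ : R => r) (fun s : R => s) G); auto;
    [apply continuous_const | apply continuous_id].
Qed.

(** * Integrals over the angle and their dependence on the radius *)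

(** Differentiation under the integral sign. [is_derive_RInt_param] speaks of [Derive]; this agrees
    with [dG] on the whole strip [a < s < b], so joint continuity carries over. *)
Lemma is_derive_RInt_angle (G dG : R -> R -> R) (a b r : R) :
  (forall s t, a < s < b -> is_derive (fun x => G x t) s (dG s t)) ->
  (forall s t, a < s < b -> continuous (fun q : R * R => G (fst q) (snd q)) (s, t)) ->
  (forall s t, a < s < b -> continuous (fun q : R * R => dG (fst q) (snd q)) (s, t)) ->
  a < r < b ->
  is_derive (fun s => RInt (G s) (- PI) PI) r (RInt (dG r) (- PI) PI).
Proof.
  intros HD HG HdG Hr.
  assert (Hloc : locally r (fun s => a < s < b)).
  { apply (locally_interval _ r a b); simpl; try apply Hr; intros; split; auto. }
  replace (RInt (dG r) (- PI) PI) with (RInt (fun t => Derive (fun s => G s t) r) (- PI) PI).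
  - apply (is_derive_RInt_param G (- PI) PI r).
    + revert Hloc; apply filter_imp; intros s Hs t _; exists (dG s t); auto.
    + intros t _; apply continuity_2d_pt_filterlim; cbv beta.
      replace (Derive (fun z : R => G z t) r) with (dG r t)
        by (symmetry; apply is_derive_unique; auto).
      apply (filterlim_ext_loc (fun q : R * R => dG (fst q) (snd q))); [|apply HdG; auto].
      destruct Hloc as [e He]; exists e; intros [s x] [Hs _]; simpl.
      symmetry; apply is_derive_unique, HD, He, Hs.
    + revert Hloc; apply filter_imp; intros s Hs.
      apply (ex_RInt_continuous (V := R_CompleteNormedModule)); intros t _; apply continuous_slice; auto.
  - apply RInt_ext; intros t _; apply is_derive_unique; auto.
Qed.

(** This removes angular derivatives from circle integrals. *)
Lemma RInt_derive_periodic (f df : R -> R) :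
  (forall t, is_derive f t (df t)) -> (forall t, continuous df t) -> f PI = f (- PI) ->
  RInt df (- PI) PI = 0.
Proof.
  intros H1 H2 H3.
  rewrite (is_RInt_unique df (- PI) PI (minus (f PI) (f (- PI)))).
  - rewrite H3; apply (minus_eq_zero (G := R_AbelianGroup)).
  - apply (is_RInt_derive f df); auto.
Qed.

(** The mean value theorem between [p] and [x] gives a point strictly between them, hence different
    from [p]. The exception at [p] serves for radius 0, where arguments dividing by the radius
    fail. *)
Lemma eq_of_derive_zero_off_point (f f' : R -> R) (a b p x : R) :
  (forall y, a < y < b -> is_derive f y (f' y)) ->
  (forall y, a < y < b -> y <> p -> f' y = 0) ->
  a < p < b -> a < x < b -> f x = f p.
Proof.
  intros HD HZ Hp Hx.
  destruct (Rtotal_order p x) as [H|[H|H]]; [| subst; reflexivity |].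
  - destruct (MVT_cor2 f f' p x H) as [y [Hy1 Hy2]].
    { intros y Hy; apply is_derive_Reals, HD; lra. }
    rewrite HZ in Hy1; lra.
  - destruct (MVT_cor2 f f' x p H) as [y [Hy1 Hy2]].
    { intros y Hy; apply is_derive_Reals, HD; lra. }
    rewrite HZ in Hy1; lra.
Qed.

(** * Circle means of conjugate pairs *)

Lemma polar_period c r : polar c r PI = polar c r (- PI).
Proof. unfold polar; rewrite cos_neg, sin_neg, sin_PI; f_equal; ring. Qed.

Lemma polar_0 c t : polar c 0 t = c.
Proof. destruct c; unfold polar; simpl; f_equal; ring. Qed.

(* The Cauchy-Riemann equations for [g - i h]; for harmonic [u] this holds with [(g, h)] the gradient of [u]. *)
Definition conjugate_pair (U : R2 -> Prop) (g h : R2 -> R) : Prop :=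
  exists gx gy hx hy, C1_on U g gx gy /\ C1_on U h hx hy /\
    forall z, U z -> gx z = - hy z /\ gy z = hx z.

(** The holomorphic function [g - i h] is multiplied by the constant [a + i b]. *)
Lemma conjugate_pair_comb U g h (a b : R) :
  conjugate_pair U g h ->
  conjugate_pair U (fun z => a * g z + b * h z) (fun z => a * h z + - b * g z).
Proof.
  intros (gx & gy & hx & hy & Hg & Hh & E).
  exists (fun z => a * gx z + b * hx z), (fun z => a * gy z + b * hy z),
    (fun z => a * hx z + - b * gx z), (fun z => a * hy z + - b * gy z).
  split; [|split]; [now apply C1_on_comb | now apply C1_on_comb |].
  intros z Hz; destruct (E z Hz) as [E1 E2]; rewrite E1, E2; split; ring.
Qed.

Ltac polar_continuity :=
  lazymatch goal with
  | |- continuous (fun q => _ (polar _ (fst q) (snd q))) _ =>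
      eapply cont_on_polar; eauto
  | |- continuous (fun q => _ + _) _ => apply (continuous_plus (V := R_NormedModule)); polar_continuity
  | |- continuous (fun q => _ - _) _ => apply (continuous_minus (V := R_NormedModule)); polar_continuity
  | |- continuous (fun q => - _) _ => apply (continuous_opp (V := R_NormedModule)); polar_continuity
  | |- continuous (fun q => _ * _) _ => apply (continuous_mult (K := R_AbsRing)); polar_continuity
  | |- continuous (fun q => cos _) _ => apply continuous_cos_snd
  | |- continuous (fun q => sin _) _ => apply continuous_sin_snd
  | |- _ => first [apply continuous_fst | apply continuous_const]
  end.

Lemma C1_on_circle_derive U F Fx Fy c a b r :
  is_open2 U -> C1_on U F Fx Fy ->
  (forall s t, a < s < b -> U (polar c s t)) -> a < r < b ->
  is_derive (fun s => RInt (fun t => F (polar c s t)) (- PI) PI) r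
    (RInt (fun t => Fx (polar c r t) * cos t + Fy (polar c r t) * sin t) (- PI) PI).
Proof.
  intros HU HF HP Hr.
  apply (is_derive_RInt_angle (fun s t => F (polar c s t))
    (fun s t => Fx (polar c s t) * cos t + Fy (polar c s t) * sin t) a b); auto.
  - intros; eapply C1_on_derive_radius; eauto.
  - intros; destruct HF as (? & ? & ? & ?); polar_continuity.
  - intros; destruct HF as (? & ? & ? & ?); polar_continuity.
Qed.

(** For [s <> 0] the Cauchy-Riemann equations turn the radial derivative of [g] into the angular
    derivative of [- h / s]. The circle integral is therefore constant in the radius across 0, where
    the circle shrinks to [c]. *)
Lemma conjugate_pair_circle_mean U g h c rho r :
  is_open2 U -> conjugate_pair U g h ->
  (forall s t, - rho < s < rho -> U (polar c s t)) -> - rho < r < rho ->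
  RInt (fun t => g (polar c r t)) (- PI) PI = 2 * PI * g c.
Proof.
  intros HU (gx & gy & hx & hy & Hg & Hh & E) HP Hr.
  assert (HD : forall s, - rho < s < rho ->
    is_derive (fun s => RInt (fun t => g (polar c s t)) (- PI) PI) s
      (RInt (fun t => gx (polar c s t) * cos t + gy (polar c s t) * sin t) (- PI) PI)).
  { intros s Hs; apply (C1_on_circle_derive U g gx gy) with (a := - rho) (b := rho); auto. }
  assert (HZ : forall s, - rho < s < rho -> s <> 0 ->
    RInt (fun t => gx (polar c s t) * cos t + gy (polar c s t) * sin t) (- PI) PI = 0).
  { intros s Hs Hs0.
    apply (RInt_derive_periodic (fun t => - / s * h (polar c s t))).
    - intros t.
      evar_last; [apply (is_derive_scal (fun t => h (polar c s t))); eapply C1_on_derive_angle; eauto|].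
      destruct (E _ (HP s t Hs)) as [E1 E2]; rewrite E1, E2; simpl; field; auto.
    - intros t; apply (continuous_slice (fun s t => gx (polar c s t) * cos t + gy (polar c s t) * sin t)).
      destruct Hg as (? & ? & ? & ?); polar_continuity.
    - now rewrite polar_period. }
  transitivity (RInt (fun t => g (polar c 0 t)) (- PI) PI).
  - apply (eq_of_derive_zero_off_point (fun s => RInt (fun t => g (polar c s t)) (- PI) PI)
      (fun s => RInt (fun t => gx (polar c s t) * cos t + gy (polar c s t) * sin t) (- PI) PI) (- rho) rho);
      [exact HD | exact HZ | lra | exact Hr].
  - rewrite (RInt_ext _ (fun _ => g c)) by (intros; now rewrite polar_0).
    rewrite RInt_const; unfold scal; simpl; unfold mult; simpl; ring.
Qed.

(** * Flux and circle means of harmonic functions, and the gradient bound they give *)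

Lemma is_derive_Rmult (f g : R -> R) (x a b : R) :
  is_derive f x a -> is_derive g x b -> is_derive (fun s => f s * g s) x (a * g x + f x * b).
Proof.
  intros Hf Hg; apply is_derive_Reals in Hf, Hg; apply is_derive_Reals.
  now apply (derivable_pt_lim_mult f g).
Qed.

(** Meant to follow [evar_last]: the derivative is built from the shape of the function, taking
    hypotheses for the functions of [polar], and only then compared with the wanted formula. *)
Ltac derive_sums :=
  lazymatch goal with
  | |- is_derive (fun s => _ (polar _ _ _)) _ _ => eassumption
  | |- is_derive (fun s => @?f s + @?g s) _ _ =>
      apply (is_derive_plus (V := R_NormedModule) f g); derive_sums
  | |- is_derive (fun s => @?f s - @?g s) _ _ =>
      apply (is_derive_minus (V := R_NormedModule) f g); derive_sums
  | |- is_derive (fun s => @?f s * @?g s) _ _ => apply (is_derive_Rmult f g); derive_sums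
  | |- is_derive (fun s => s) _ _ => apply is_derive_id
  | |- is_derive (fun s => cos s) _ _ => apply is_derive_cos
  | |- is_derive cos _ _ => apply is_derive_cos
  | |- is_derive (fun s => sin s) _ _ => apply is_derive_sin
  | |- is_derive sin _ _ => apply is_derive_sin
  | |- _ => apply (is_derive_const (V := R_NormedModule))
  end.

(* The radial derivative of the integrand equals the angular derivative of [g sin t - h cos t]. *)
Lemma circle_flux_constant U g h c a b r :
  is_open2 U -> conjugate_pair U g h ->
  (forall s t, a < s < b -> U (polar c s t)) -> a < r < b ->
  is_derive (fun s => RInt (fun t => s * (g (polar c s t) * cos t + h (polar c s t) * sin t)) (- PI) PI) r 0.
Proof.
  intros HU (gx & gy & hx & hy & Hg & Hh & E) HP Hr.
  set (dG := fun s t => (g (polar c s t) * cos t + h (polar c s t) * sin t) +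
    s * ((gx (polar c s t) * cos t + gy (polar c s t) * sin t) * cos t +
         (hx (polar c s t) * cos t + hy (polar c s t) * sin t) * sin t)).
  assert (HdG : forall s t, a < s < b -> continuous (fun q : R * R => dG (fst q) (snd q)) (s, t)).
  { intros; unfold dG; destruct Hg as (? & ? & ? & ?), Hh as (? & ? & ? & ?); polar_continuity. }
  rewrite <- (RInt_derive_periodic (fun t => g (polar c r t) * sin t - h (polar c r t) * cos t) (dG r)).
  - apply (is_derive_RInt_angle (fun s t => s * (g (polar c s t) * cos t + h (polar c s t) * sin t)) dG a b); auto.
    + intros s t Hs; unfold dG.
      pose proof (C1_on_derive_radius U g gx gy c s t HU Hg (HP s t Hs)) as D1.
      pose proof (C1_on_derive_radius U h hx hy c s t HU Hh (HP s t Hs)) as D2.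
      evar_last.
      { derive_sums. }
      unfold plus, zero, one; simpl; ring.
    + intros; destruct Hg as (? & ? & ? & ?), Hh as (? & ? & ? & ?); polar_continuity.
  - intros t; unfold dG.
    pose proof (C1_on_derive_angle U g gx gy c r t HU Hg (HP r t Hr)) as D1.
    pose proof (C1_on_derive_angle U h hx hy c r t HU Hh (HP r t Hr)) as D2.
    evar_last.
    { derive_sums. }
    destruct (E _ (HP r t Hr)) as [E1 E2]; rewrite E1, E2.
    unfold minus, plus, opp; simpl; ring.
  - intros t; apply (continuous_slice dG); auto.
  - rewrite polar_period, cos_neg, sin_neg, sin_PI; ring.
Qed.

Lemma ex_RInt_polar U F c r (w : R -> R) :
  is_open2 U -> cont_on U F -> (forall t, U (polar c r t)) -> (forall t, continuous w t) ->
  ex_RInt (fun t => F (polar c r t) * w t) (- PI) PI.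
Proof.
  intros HU HF HP Hw; apply (ex_RInt_continuous (V := R_CompleteNormedModule)); intros t _.
  apply (continuous_mult (K := R_AbsRing)); [|apply Hw].
  apply (continuous_slice (fun s t => F (polar c s t))), (cont_on_polar U); auto.
Qed.

(** With the radius outside the integral, radius 0 may be inserted when the interval contains it.
    The flux then vanishes; on an annulus it may not. *)
Lemma circle_flux_eq U g h c a b r1 r2 :
  is_open2 U -> conjugate_pair U g h ->
  (forall s t, a < s < b -> U (polar c s t)) -> a < r1 < b -> a < r2 < b ->
  r1 * RInt (fun t => g (polar c r1 t) * cos t + h (polar c r1 t) * sin t) (- PI) PI =
  r2 * RInt (fun t => g (polar c r2 t) * cos t + h (polar c r2 t) * sin t) (- PI) PI.
Proof.
  intros HU HC HP H1 H2.
  assert (HS : forall s, a < s < b ->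
    RInt (fun t => s * (g (polar c s t) * cos t + h (polar c s t) * sin t)) (- PI) PI =
    s * RInt (fun t => g (polar c s t) * cos t + h (polar c s t) * sin t) (- PI) PI).
  { intros s Hs; apply (RInt_scal (V := R_CompleteNormedModule)).
    destruct HC as (gx & gy & hx & hy & (_ & Hg & _) & (_ & Hh & _) & _).
    apply (ex_RInt_plus (V := R_CompleteNormedModule)); apply (ex_RInt_polar U); auto; intros t.
    - apply continuous_cos.
    - apply continuous_sin. }
  rewrite <- !HS by auto.
  apply (eq_of_derive_zero_off_point
    (fun s => RInt (fun t => s * (g (polar c s t) * cos t + h (polar c s t) * sin t)) (- PI) PI)
    (fun _ => 0) a b); auto.
  intros y Hy; apply (circle_flux_constant U) with (a := a) (b := b); auto.
Qed.

(** The derivative of the circle integral is the flux divided by the radius, and comparison with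
    radius 0 shows that the flux is 0. *)
Lemma harmonic_circle_mean U u g h c rho r :
  is_open2 U -> C1_on U u g h -> conjugate_pair U g h ->
  (forall s t, - rho < s < rho -> U (polar c s t)) -> - rho < r < rho ->
  RInt (fun t => u (polar c r t)) (- PI) PI = 2 * PI * u c.
Proof.
  intros HU Hu HC HP Hr.
  transitivity (RInt (fun t => u (polar c 0 t)) (- PI) PI).
  - apply (eq_of_derive_zero_off_point (fun s => RInt (fun t => u (polar c s t)) (- PI) PI)
      (fun s => RInt (fun t => g (polar c s t) * cos t + h (polar c s t) * sin t) (- PI) PI)
      (- rho) rho); auto; [| |lra].
    + intros y Hy; eapply C1_on_circle_derive; eauto.
    + intros y Hy Hy0.
      assert (E := circle_flux_eq U g h c (- rho) rho y 0 HU HC HP Hy ltac:(lra)).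
      rewrite Rmult_0_l in E; apply Rmult_integral in E; destruct E; [contradiction|auto].
  - rewrite (RInt_ext _ (fun _ => u c)) by (intros; now rewrite polar_0).
    rewrite RInt_const; unfold scal; simpl; unfold mult; simpl; ring.
Qed.

(** Here the circles may surround a hole, so the flux [k] can be nonzero; the circle integral then
    has derivative [k / r]. *)
Lemma harmonic_circle_mean_log U u g h c R0 :
  is_open2 U -> C1_on U u g h -> conjugate_pair U g h -> 0 <= R0 ->
  (forall s t, R0 < s -> U (polar c s t)) ->
  exists A k, forall r, R0 < r -> RInt (fun t => u (polar c r t)) (- PI) PI = A + k * ln r.
Proof.
  intros HU Hu HC HR HP.
  set (J := fun s => RInt (fun t => g (polar c s t) * cos t + h (polar c s t) * sin t) (- PI) PI).
  set (I := fun s => RInt (fun t => u (polar c s t)) (- PI) PI).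
  (* [p] is a reference radius and [k] the flux through its circle. *)
  set (p := R0 + 1); set (k := p * J p).
  exists (I p - k * ln p), k; intros r Hr.
  (* [b] only closes off a bounded interval of radii that contains [p] and [r]. *)
  pose proof (Rmax_l p r); pose proof (Rmax_r p r); set (b := Rmax p r + 1).
  assert (Ep : p = R0 + 1) by reflexivity; assert (Eb : b = Rmax p r + 1) by reflexivity.
  assert (Hpb : R0 < p < b) by lra.
  assert (Hrb : R0 < r < b) by lra.
  assert (HP' : forall s t, R0 < s < b -> U (polar c s t)) by (intros; apply HP; lra).
  enough (I r - k * ln r = I p - k * ln p) by (unfold I in *; lra).
  apply (eq_of_derive_zero_off_point (fun s => I s - k * ln s) (fun s => J s - k * / s) R0 b); auto.
  - intros y Hy; apply (is_derive_minus (V := R_NormedModule) I (fun s => k * ln s)).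
    + eapply C1_on_circle_derive; eauto.
    + apply (is_derive_scal ln), is_derive_ln; lra.
  - intros y Hy _.
    assert (E : y * J y = k).
    { apply (circle_flux_eq U g h c R0 b); auto. }
    rewrite <- E; field; lra.
Qed.

(* Differentiating the left side in [r] gives [r] times the circle integral of [a g + b h],
   up to the angular derivative of [u (a sin t - b cos t)]. *)
Lemma harmonic_circle_moment U u g h c rho r a b :
  is_open2 U -> C1_on U u g h -> conjugate_pair U g h ->
  (forall s t, - rho < s < rho -> U (polar c s t)) -> 0 <= r < rho ->
  r * RInt (fun t => u (polar c r t) * (a * cos t + b * sin t)) (- PI) PI =
  PI * r ^ 2 * (a * g c + b * h c).
Proof.
  intros HU Hu HC HP Hr.
  set (G := fun s t => s * (u (polar c s t) * (a * cos t + b * sin t))).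
  set (w := fun z => a * g z + b * h z).
  set (dG := fun s t => u (polar c s t) * (a * cos t + b * sin t) +
    s * ((g (polar c s t) * cos t + h (polar c s t) * sin t) * (a * cos t + b * sin t))).
  pose proof Hu as (_ & Cu & Cg & Ch).
  assert (Cw : cont_on U w) by (unfold w; apply cont_on_plus; apply cont_on_mult; auto; apply cont_on_const).
  assert (HdG : forall s t, - rho < s < rho -> continuous (fun q : R * R => dG (fst q) (snd q)) (s, t)).
  { intros; unfold dG; polar_continuity. }
  assert (HW : forall s, - rho < s < rho -> RInt (dG s) (- PI) PI = s * (2 * PI * w c)).
  { intros s Hs.
    rewrite <- (conjugate_pair_circle_mean U w (fun z => a * h z + - b * g z) c rho s); auto;
      [|now apply conjugate_pair_comb].
    assert (Ew : ex_RInt (fun t => w (polar c s t)) (- PI) PI).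
    { apply (ex_RInt_ext (fun t => w (polar c s t) * 1)); [intros; apply Rmult_1_r|].
      apply (ex_RInt_polar U); auto; intros; apply continuous_const. }
    rewrite <- (RInt_scal (V := R_CompleteNormedModule)) by exact Ew.
    apply Rminus_diag_uniq.
    rewrite <- (RInt_minus (V := R_CompleteNormedModule)).
    - apply (RInt_derive_periodic (fun t => u (polar c s t) * (a * sin t - b * cos t))).
      + intros t.
        pose proof (C1_on_derive_angle U u g h c s t HU Hu (HP s t Hs)) as D1.
        evar_last; [derive_sums|].
        assert (P : cos t ^ 2 = 1 - sin t ^ 2) by (pose proof (sin2_cos2 t); unfold Rsqr in *; lra).
        unfold dG, w, scal, minus, plus, opp, zero; simpl; unfold mult; simpl; ring [P].
      + intros t.
        apply (continuous_slice (fun s t => minus (dG s t) (scal s (w (polar c s t))))).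
        apply (continuous_minus (V := R_NormedModule)); [auto|].
        apply (continuous_mult (K := R_AbsRing)); [apply continuous_fst|].
        apply (cont_on_polar U); auto.
      + rewrite polar_period, cos_neg, sin_neg, sin_PI; ring.
    - apply (ex_RInt_continuous (V := R_CompleteNormedModule)); intros t _.
      apply (continuous_slice dG); auto.
    - now apply (ex_RInt_scal (V := R_CompleteNormedModule)). }
  (* By [HW] the moment has derivative [2 * PI * w c * s], whose primitive is the quadratic term
     subtracted here; both terms vanish at radius 0. *)
  assert (HD : forall s, - rho < s < rho ->
    is_derive (fun s => RInt (G s) (- PI) PI - PI * w c * (s * s)) s 0).
  { intros s Hs; evar_last.
    - apply (is_derive_minus (V := R_NormedModule) (fun s => RInt (G s) (- PI) PI)).
      + apply (is_derive_RInt_angle G dG (- rho) rho); auto.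
        * intros x t Hx; unfold G.
          pose proof (C1_on_derive_radius U u g h c x t HU Hu (HP x t Hx)) as D1.
          evar_last; [derive_sums|].
          unfold dG, plus, zero, one; simpl; ring.
        * intros x t Hx; unfold G; polar_continuity.
      + derive_sums.
    - rewrite HW by auto; unfold minus, plus, opp, zero, one; simpl; ring. }
  assert (E := eq_of_derive_zero_off_point _ _ (- rho) rho 0 r HD (fun _ _ _ => eq_refl) ltac:(lra) ltac:(lra)).
  cbv beta in E.
  assert (HG : forall s, - rho < s < rho -> RInt (G s) (- PI) PI =
    s * RInt (fun t => u (polar c s t) * (a * cos t + b * sin t)) (- PI) PI).
  { intros s Hs; unfold G; apply (RInt_scal (V := R_CompleteNormedModule)).
    apply (ex_RInt_polar U); auto; intros t.
    apply (continuous_of_derive _ _ (a * - sin t + b * cos t)).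
    auto_derive; auto; ring. }
  rewrite !HG in E by lra.
  unfold w in E; lra.
Qed.

(** The moment formula writes the directional derivative at [c] as an integral of [u] against a
    weight of absolute value at most 1. Positivity of [u] bounds that integral by the integral of
    [u], which is [2 * PI * u c]. *)
Lemma positive_harmonic_gradient_bound U u g h c rho r a b :
  is_open2 U -> C1_on U u g h -> conjugate_pair U g h ->
  (forall z, U z -> 0 < u z) ->
  (forall s t, - rho < s < rho -> U (polar c s t)) -> 0 < r < rho ->
  a ^ 2 + b ^ 2 = 1 ->
  r * Rabs (a * g c + b * h c) <= 2 * u c.
Proof.
  intros HU Hu HC Hpos HP Hr Hab.
  pose proof Hu as (_ & Cu & _).
  assert (Hw : forall t, continuous (fun t => a * cos t + b * sin t) t).
  { intros t; apply (continuous_of_derive _ _ (a * - sin t + b * cos t)); auto_derive; auto; ring. }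
  assert (Hex := ex_RInt_polar U u c r _ HU Cu (fun t => HP r t ltac:(lra)) Hw).
  assert (Hex1 : ex_RInt (fun t => u (polar c r t)) (- PI) PI).
  { apply (ex_RInt_ext (fun t => u (polar c r t) * 1)); [intros; apply Rmult_1_r|].
    apply (ex_RInt_polar U); auto; intros; [apply HP; lra | apply continuous_const]. }
  assert (E1 := harmonic_circle_moment U u g h c rho r a b HU Hu HC HP ltac:(lra)).
  assert (E2 := harmonic_circle_mean U u g h c rho r HU Hu HC HP ltac:(lra)).
  pose proof PI_RGT_0.
  assert (B : Rabs (RInt (fun t => u (polar c r t) * (a * cos t + b * sin t)) (- PI) PI) <=
              2 * PI * u c).
  { rewrite <- E2; eapply Rle_trans; [apply abs_RInt_le; [lra|exact Hex]|].
    apply RInt_le; [lra | | exact Hex1 |].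
    - apply (ex_RInt_norm); exact Hex.
    - intros t _.
      assert (U0 := Hpos _ (HP r t ltac:(lra))).
      rewrite Rabs_mult, (Rabs_pos_eq (u _)) by lra.
      (* The squares of [a * cos t + b * sin t] and [a * sin t - b * cos t] add up to 1. *)
      assert (Rabs (a * cos t + b * sin t) <= 1).
      { apply Rsqr_le_abs_0_alt || idtac.
        rewrite <- (Rabs_pos_eq 1) by lra; apply Rsqr_le_abs_0; unfold Rsqr.
        pose proof (sin2_cos2 t) as S; unfold Rsqr in S.
        pose proof (Rle_0_sqr (a * sin t - b * cos t)) as Q; unfold Rsqr in Q.
        replace (1 * 1) with ((a ^ 2 + b ^ 2) * (sin t * sin t + cos t * cos t)) by (rewrite S, Hab; ring).
        nra. }
      nra. }
  assert (E3 : RInt (fun t => u (polar c r t) * (a * cos t + b * sin t)) (- PI) PI =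
    PI * (r * (a * g c + b * h c))).
  { apply Rmult_eq_reg_l with r; [|lra]; rewrite E1; ring. }
  rewrite E3, !Rabs_mult, (Rabs_pos_eq PI), (Rabs_pos_eq r) in B by lra.
  apply Rmult_le_reg_l with PI; lra.
Qed.

(** * Polar coordinates and the norm *)

Lemma dist2_polar c s t : dist2 (polar c s t) c = Rabs s.
Proof.
  unfold dist2, norm2, polar; simpl; rewrite <- sqrt_Rsqr_abs; f_equal.
  pose proof (sin2_cos2 t) as E; unfold Rsqr in *.
  transitivity (s * s * (sin t * sin t + cos t * cos t)); [ring | rewrite E; ring].
Qed.

Lemma polar_add_PI c s t : polar c s (t + PI) = polar c (- s) t.
Proof. unfold polar; rewrite neg_cos, neg_sin; f_equal; ring. Qed.

(** A signed radius lets the angle come from [atan], or be [PI / 2] on the vertical line through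
    [c]. It is thus interior to [[- PI, PI]], as the strong maximum principle requires. *)
Lemma polar_coordinates c z :
  exists s t, - PI < t < PI /\ z = polar c s t /\ Rabs s = dist2 z c.
Proof.
  enough (exists s t, - PI < t < PI /\ z = polar c s t) as (s & t & Ht & E).
  { exists s, t; split; [|split]; auto; rewrite E, dist2_polar; auto. }
  pose proof PI_RGT_0.
  destruct c as [p q], z as [x y]; unfold polar; simpl.
  destruct (Req_dec x p) as [->|Hx].
  - exists (y - q), (PI / 2); split; [lra|]; rewrite cos_PI2, sin_PI2; f_equal; ring.
  - set (m := (y - q) / (x - p)).
    exists ((x - p) / cos (atan m)), (atan m).
    destruct (atan_bound m) as [B1 B2].
    assert (Hc : 0 < cos (atan m)) by (apply cos_gt_0; lra).
    split; [lra|]; f_equal.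
    + field; lra.
    + assert (T := tan_atan m); unfold tan in T.
      replace ((x - p) / cos (atan m) * sin (atan m)) with ((x - p) * (sin (atan m) / cos (atan m)))
        by (field; lra).
      rewrite T; unfold m; field; lra.
Qed.

(** A negative radius changes sign when [PI] is added to the angle, hence the range up to
    [2 * PI]. *)
Lemma polar_coordinates_nonneg c z :
  exists t, - PI < t < 2 * PI /\ z = polar c (dist2 z c) t.
Proof.
  destruct (polar_coordinates c z) as (s & t & Ht & E & Hs); pose proof PI_RGT_0.
  rewrite <- Hs; destruct (Rle_dec 0 s) as [H0|H0].
  - exists t; rewrite Rabs_pos_eq by auto; split; [lra|auto].
  - exists (t + PI); rewrite polar_add_PI, Rabs_left, Ropp_involutive by lra; split; [lra|auto].
Qed.

Lemma norm2_le_add_dist2 z c : norm2 c <= norm2 z + dist2 z c.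
Proof.
  pose proof (triangle (fst c) (snd c) 0 0 (fst z) (snd z)) as T.
  unfold dist_euc in T; unfold dist2, norm2; simpl.
  replace (fst c * (fst c * 1) + snd c * (snd c * 1)) with ((fst c - 0)² + (snd c - 0)²) by (unfold Rsqr; ring).
  replace (fst z * (fst z * 1) + snd z * (snd z * 1)) with ((fst z - 0)² + (snd z - 0)²) by (unfold Rsqr; ring).
  replace ((fst z - fst c) * ((fst z - fst c) * 1) + (snd z - snd c) * ((snd z - snd c) * 1))
    with ((fst c - fst z)² + (snd c - snd z)²) by (unfold Rsqr; ring).
  lra.
Qed.

Lemma dist2_origin z : dist2 z (0, 0) = norm2 z.
Proof. unfold dist2; simpl; rewrite !Rminus_0_r; destruct z; reflexivity. Qed.

Lemma norm2_polar_origin s t : norm2 (polar (0, 0) s t) = Rabs s.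
Proof. rewrite <- dist2_origin; apply dist2_polar. Qed.

(** * Harnack inequality, growth and gradient decay outside a large disk *)

(** The disk of radius [norm2 c / 2] about [c] stays in the region [R0 < norm2 z]. The gradient
    bound is taken at radius [norm2 c / 4], whence the constant 8. *)
Lemma exterior_gradient_bound U u g h R0 c a b :
  is_open2 U -> C1_on U u g h -> conjugate_pair U g h ->
  (forall z, U z -> 0 < u z) -> 0 < R0 -> (forall z, R0 < norm2 z -> U z) ->
  2 * R0 < norm2 c -> a ^ 2 + b ^ 2 = 1 ->
  norm2 c * Rabs (a * g c + b * h c) <= 8 * u c.
Proof.
  intros HU Hu HC Hpos HR HE Hc Hab.
  assert (B : norm2 c / 4 * Rabs (a * g c + b * h c) <= 2 * u c).
  { apply (positive_harmonic_gradient_bound U) with (rho := norm2 c / 2); auto; [|lra].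
    intros s t Hs; apply HE.
    pose proof (norm2_le_add_dist2 (polar c s t) c) as T; rewrite dist2_polar in T.
    assert (Rabs s < norm2 c / 2) by (apply Rabs_def1; lra); lra. }
  lra.
Qed.

Lemma exp_nondecreasing (x y : R) : x <= y -> exp x <= exp y.
Proof. intros [H | ->]; [apply Rlt_le, exp_increasing, H | apply Rle_refl]. Qed.

(** In the tangential direction [(- sin t, cos t)] the gradient bound says that the angular
    derivative of [ln u] is at most 8 in absolute value. *)
Lemma exterior_harnack U u g h R0 r t1 t2 :
  is_open2 U -> C1_on U u g h -> conjugate_pair U g h ->
  (forall z, U z -> 0 < u z) -> 0 < R0 -> (forall z, R0 < norm2 z -> U z) ->
  2 * R0 < r ->
  u (polar (0, 0) r t1) <= exp (8 * Rabs (t1 - t2)) * u (polar (0, 0) r t2).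
Proof.
  intros HU Hu HC Hpos HR HE Hr.
  assert (Hin : forall t, U (polar (0, 0) r t)).
  { intros t; apply HE; rewrite norm2_polar_origin, Rabs_pos_eq; lra. }
  assert (P : forall t, 0 < u (polar (0, 0) r t)) by auto.
  set (v := fun t => u (polar (0, 0) r t)).
  set (dv := fun t => g (polar (0, 0) r t) * (- r * sin t) + h (polar (0, 0) r t) * (r * cos t)).
  assert (B : norm (minus (ln (v t1)) (ln (v t2))) <= 8 * Rabs (t1 - t2)).
  (* [bounded_variation] is the mean value inequality. *)
  { apply (bounded_variation (fun t => ln (v t)) (fun t => dv t * / v t)).
    intros t _; split.
    - apply (is_derive_comp ln v); [apply is_derive_ln, P|].
      apply (C1_on_derive_angle U); auto.
    - assert (G := exterior_gradient_bound U u g h R0 (polar (0, 0) r t) (- sin t) (cos t)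
        HU Hu HC Hpos HR HE).
      rewrite norm2_polar_origin, Rabs_pos_eq in G by lra.
      specialize (G ltac:(lra)).
      assert (S : (- sin t) ^ 2 + cos t ^ 2 = 1) by (pose proof (sin2_cos2 t); unfold Rsqr in *; lra).
      specialize (G S).
      change (Rabs (dv t * / v t) <= 8).
      rewrite Rabs_mult, Rabs_inv, (Rabs_pos_eq (v t)) by (apply Rlt_le, P).
      apply Rmult_le_reg_r with (v t); [apply P|].
      rewrite Rmult_assoc, Rinv_l, Rmult_1_r by (apply Rgt_not_eq, P).
      replace (dv t) with (r * (- sin t * g (polar (0, 0) r t) + cos t * h (polar (0, 0) r t)))
        by (unfold dv; ring).
      rewrite Rabs_mult, (Rabs_pos_eq r) by lra; exact G. }
  change (Rabs (ln (v t1) - ln (v t2)) <= 8 * Rabs (t1 - t2)) in B.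
  apply Rle_trans with (exp (ln (v t1))); [rewrite exp_ln; [apply Rle_refl | apply P]|].
  apply Rle_trans with (exp (8 * Rabs (t1 - t2) + ln (v t2))).
  - apply exp_nondecreasing; pose proof (Rle_abs (ln (v t1) - ln (v t2))); lra.
  - rewrite exp_plus, (exp_ln (v t2)) by apply P; apply Rle_refl.
Qed.

(** Harnack bounds [u z] by [C] times the value of [u] at any point of the circle through [z];
    averaging over that circle brings in the logarithmic mean. *)
Lemma exterior_log_growth U u g h R0 :
  is_open2 U -> C1_on U u g h -> conjugate_pair U g h ->
  (forall z, U z -> 0 < u z) -> 0 < R0 -> (forall z, R0 < norm2 z -> U z) ->
  exists A k, forall z, 2 * R0 < norm2 z -> u z <= A + k * ln (norm2 z).
Proof.
  intros HU Hu HC Hpos HR HE.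
  destruct (harmonic_circle_mean_log U u g h (0, 0) R0) as (A & k & HI); auto; [lra| |].
  { intros s t Hs; apply HE; rewrite norm2_polar_origin, Rabs_pos_eq; lra. }
  (* The angle of [z] lies between [- PI] and [2 * PI], the integration variable between [- PI] and
     [PI], so they differ by at most [3 * PI]. *)
  pose proof PI_RGT_0 as HPI; set (C := exp (8 * (3 * PI))).
  exists (C / (2 * PI) * A), (C / (2 * PI) * k); intros z Hz.
  destruct (polar_coordinates_nonneg (0, 0) z) as (t0 & Ht0 & E).
  rewrite dist2_origin in E; set (r := norm2 z) in *.
  assert (Ex : ex_RInt (fun t => u (polar (0, 0) r t)) (- PI) PI).
  { apply (ex_RInt_ext (fun t => u (polar (0, 0) r t) * 1)); [intros; apply Rmult_1_r|].
    apply (ex_RInt_polar U); auto; [apply Hu | | intros; apply continuous_const].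
    intros t; apply HE; rewrite norm2_polar_origin, Rabs_pos_eq; lra. }
  assert (L : RInt (fun _ => u z) (- PI) PI <= RInt (fun t => C * u (polar (0, 0) r t)) (- PI) PI).
  { apply RInt_le; [lra | apply ex_RInt_const | now apply (ex_RInt_scal (V := R_NormedModule)) |].
    intros t Ht; rewrite E.
    eapply Rle_trans; [apply (exterior_harnack U u g h R0 r t0 t); auto|].
    apply Rmult_le_compat_r.
    - apply Rlt_le, Hpos, HE; rewrite norm2_polar_origin, Rabs_pos_eq; lra.
    - apply exp_nondecreasing; assert (Rabs (t0 - t) <= 3 * PI) by (apply Rabs_le; lra); lra. }
  rewrite RInt_const in L.
  rewrite (RInt_scal (V := R_CompleteNormedModule)), HI in L by (auto; lra).
  unfold scal in L; simpl in L; unfold mult in L; simpl in L.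
  apply Rmult_le_reg_l with (2 * PI); [lra|].
  replace (2 * PI * (C / (2 * PI) * A + C / (2 * PI) * k * ln r)) with (C * (A + k * ln r)) by (field; lra).
  lra.
Qed.

(** The unit vector [(x / n, y / n)] realises the norm. This turns bounds on directional derivatives
    into a bound on the gradient. *)
Lemma euclid_norm_le_of_components (x y M : R) :
  0 <= M -> (forall a b, a ^ 2 + b ^ 2 = 1 -> Rabs (a * x + b * y) <= M) -> sqrt (x ^ 2 + y ^ 2) <= M.
Proof.
  intros HM H; set (n := sqrt (x ^ 2 + y ^ 2)).
  destruct (Rle_lt_or_eq_dec 0 n (sqrt_pos _)) as [Hn|Hn]; [|lra].
  assert (En : n * n = x ^ 2 + y ^ 2) by (apply sqrt_sqrt; nra).
  assert (S : (x / n) ^ 2 + (y / n) ^ 2 = 1).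
  { replace ((x / n) ^ 2 + (y / n) ^ 2) with ((x ^ 2 + y ^ 2) / (n * n)) by (field; lra).
    rewrite <- En; field; lra. }
  specialize (H _ _ S).
  replace (x / n * x + y / n * y) with n in H; [pose proof (Rle_abs n); lra|].
  replace (x / n * x + y / n * y) with ((x ^ 2 + y ^ 2) / n) by (field; lra).
  rewrite <- En; field; lra.
Qed.

Lemma log_over_linear_small (A k eps : R) :
  0 < eps -> exists M, 0 < M /\ forall r, M < r -> A + k * ln r < eps * r.
Proof.
  intros He.
  assert (L : is_lim (fun r => A * / r + k * (ln r / r)) p_infty (A * 0 + k * 0)).
  { apply (is_lim_plus' _ _ _ (A * 0) (k * 0)).
    - apply (is_lim_scal_l Rinv A p_infty 0).
      apply (is_lim_inv (fun r => r) p_infty p_infty); [apply is_lim_id | discriminate].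
    - apply (is_lim_scal_l (fun r => ln r / r) k p_infty 0), is_lim_div_ln_p. }
  apply is_lim_spec in L; destruct (L (mkposreal eps He)) as [M HM]; simpl in HM.
  exists (Rmax M 1); split; [eapply Rlt_le_trans; [apply Rlt_0_1 | apply Rmax_r]|].
  intros r Hr; pose proof (Rmax_l M 1); pose proof (Rmax_r M 1).
  specialize (HM r ltac:(lra)); apply Rabs_def2 in HM; destruct HM as [HM _].
  replace (A + k * ln r) with ((A * / r + k * (ln r / r)) * r) by (field; lra).
  apply Rmult_lt_compat_r; lra.
Qed.

(** The norm of the gradient times [norm2 z] is at most [8 * u z], which grows at most
    logarithmically and so falls below [eps * norm2 z]. *)
Lemma exterior_gradient_vanishes U u g h R0 eps :
  is_open2 U -> C1_on U u g h -> conjugate_pair U g h ->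
  (forall z, U z -> 0 < u z) -> 0 < R0 -> (forall z, R0 < norm2 z -> U z) ->
  0 < eps ->
  exists M, R0 < M /\ forall z, M < norm2 z -> sqrt (g z ^ 2 + h z ^ 2) < eps.
Proof.
  intros HU Hu HC Hpos HR HE He.
  destruct (exterior_log_growth U u g h R0) as (A & k & HA); auto.
  destruct (log_over_linear_small (8 * A) (8 * k) eps He) as (M & HM0 & HM).
  exists (M + 2 * R0); split; [lra|]; intros z Hz.
  assert (Hn : 0 < norm2 z) by lra.
  apply Rmult_lt_reg_l with (norm2 z); auto.
  apply Rle_lt_trans with (8 * u z).
  - apply Rmult_le_reg_l with (/ norm2 z); [now apply Rinv_0_lt_compat|].
    rewrite <- Rmult_assoc, Rinv_l, Rmult_1_l by lra.
    assert (U z) by (apply HE; lra).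
    apply euclid_norm_le_of_components.
    + pose proof (Hpos z H); apply Rmult_le_pos; [apply Rlt_le, Rinv_0_lt_compat; auto | lra].
    + intros a b Hab; apply Rmult_le_reg_l with (norm2 z); auto.
      rewrite <- Rmult_assoc, Rinv_r, Rmult_1_l by lra.
      apply (exterior_gradient_bound U u g h R0); auto; lra.
  - specialize (HA z ltac:(lra)); specialize (HM (norm2 z) ltac:(lra)); lra.
Qed.

(** * The gradient of a harmonic function as a conjugate pair *)

Lemma open_locally_fst U x y : is_open2 U -> U (x, y) -> locally x (fun z => U (z, y)).
Proof.
  intros HU Hz; destruct (open_locally U (x, y) HU Hz) as [e He]; exists e; intros z Hzx.
  apply He; split; [exact Hzx | apply ball_center].
Qed.

Lemma open_locally_snd U x y : is_open2 U -> U (x, y) -> locally y (fun z => U (x, z)).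
Proof.
  intros HU Hz; destruct (open_locally U (x, y) HU Hz) as [e He]; exists e; intros z Hzx.
  apply He; split; [apply ball_center | exact Hzx].
Qed.

(** Schwarz's theorem: the iterated [Derive] of [u] coincide with [gy] and [hx] throughout the open
    set [U] and inherit their continuity. *)
Lemma C1_on_mixed_partials U u g h gx gy hx hy z :
  is_open2 U -> C1_on U u g h -> C1_on U g gx gy -> C1_on U h hx hy -> U z -> gy z = hx z.
Proof.
  intros HU (Du & _) (Dg & _ & _ & Cgy) (Dh & _ & Chx & _) Hz.
  destruct z as [x y].
  assert (D1 : forall p q, U (p, q) -> Derive (fun s => u (s, q)) p = g (p, q)).
  { intros p q Hp; apply is_derive_unique, is_derive_Reals, (proj1 (Du _ Hp)). }
  assert (D2 : forall p q, U (p, q) -> Derive (fun s => u (p, s)) q = h (p, q)).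
  { intros p q Hp; apply is_derive_unique, is_derive_Reals, (proj2 (Du _ Hp)). }
  assert (D12 : forall p q, U (p, q) ->
    is_derive (fun s => Derive (fun t => u (t, s)) p) q (gy (p, q))).
  { intros p q Hp; apply (is_derive_ext_loc (fun s => g (p, s))).
    - generalize (open_locally_snd U p q HU Hp); apply filter_imp; intros s Hs; now rewrite D1.
    - apply is_derive_Reals, (proj2 (Dg _ Hp)). }
  assert (D21 : forall p q, U (p, q) ->
    is_derive (fun s => Derive (fun t => u (s, t)) q) p (hx (p, q))).
  { intros p q Hp; apply (is_derive_ext_loc (fun s => h (s, q))).
    - generalize (open_locally_fst U p q HU Hp); apply filter_imp; intros s Hs; now rewrite D2.
    - apply is_derive_Reals, (proj1 (Dh _ Hp)). }
  rewrite <- (is_derive_unique _ _ _ (D12 x y Hz)), <- (is_derive_unique _ _ _ (D21 x y Hz)).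
  pose proof (open_locally U (x, y) HU Hz) as HL.
  symmetry; apply (Schwarz (fun a b => u (a, b))).
  - apply locally_2d_locally; revert HL; apply filter_imp; intros [p q] Hp; simpl.
    repeat split.
    + exists (g (p, q)); apply is_derive_Reals, (proj1 (Du _ Hp)).
    + exists (h (p, q)); apply is_derive_Reals, (proj2 (Du _ Hp)).
    + exists (hx (p, q)); auto.
    + exists (gy (p, q)); auto.
  - apply continuity_2d_pt_filterlim; cbv beta.
    replace (Derive (fun s => Derive (fun t => u (s, t)) y) x) with (hx (x, y))
      by (symmetry; apply is_derive_unique; auto).
    apply (filterlim_ext_loc (hx : R * R -> R)).
    + revert HL; apply filter_imp; intros [p q] Hp; simpl; symmetry; apply is_derive_unique; auto.
    + exact (cont_on_continuous U hx _ HU Chx Hz).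
  - apply continuity_2d_pt_filterlim; cbv beta.
    replace (Derive (fun s => Derive (fun t => u (t, s)) x) y) with (gy (x, y))
      by (symmetry; apply is_derive_unique; auto).
    apply (filterlim_ext_loc (gy : R * R -> R)).
    + revert HL; apply filter_imp; intros [p q] Hp; simpl; symmetry; apply is_derive_unique; auto.
    + exact (cont_on_continuous U gy _ HU Cgy Hz).
Qed.

(** Laplace's equation is one Cauchy-Riemann equation for the gradient, symmetry of the mixed
    partials the other. *)
Lemma harmonic_conjugate_pair U u :
  is_open2 U -> harmonic U u -> exists g h, C1_on U u g h /\ conjugate_pair U g h.
Proof.
  intros HU [(Cu & g & h & Du & (Cg & gx & gy & Dg & Cgx & Cgy) & (Ch & hx & hy & Dh & Chx & Chy)) HL].
  simpl in *.
  assert (Hu : C1_on U u g h) by (split; [|split; [|split]]; auto).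
  assert (Hg : C1_on U g gx gy) by (split; [|split; [|split]]; auto).
  assert (Hh : C1_on U h hx hy) by (split; [|split; [|split]]; auto).
  exists g, h; split; [exact Hu|].
  exists gx, gy, hx, hy; split; [exact Hg | split; [exact Hh|]].
  intros z Hz; split.
  - assert (gx z + hy z = 0) by (apply (HL g h Du z); auto; [apply Dg | apply Dh]; auto); lra.
  - exact (C1_on_mixed_partials U u g h gx gy hx hy z HU Hu Hg Hh Hz).
Qed.

(** * Compactness and attained maxima *)

Lemma dist2_triangle x y z : dist2 x z <= dist2 x y + dist2 y z.
Proof.
  pose proof (triangle (fst x) (snd x) (fst z) (snd z) (fst y) (snd y)) as T.
  unfold dist_euc, Rsqr in T; unfold dist2, norm2; simpl; rewrite !Rmult_1_r; exact T.
Qed.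

Lemma dist2_self z : dist2 z z = 0.
Proof.
  unfold dist2, norm2; simpl; rewrite !Rminus_diag, Rmult_0_l, Rplus_0_l; apply sqrt_0.
Qed.

Lemma closure2_incl (S : R2 -> Prop) z : S z -> closure2 S z.
Proof. intros Hz e He; exists z; rewrite dist2_self; auto. Qed.

Lemma abs_le_norm2 z : Rabs (fst z) <= norm2 z /\ Rabs (snd z) <= norm2 z.
Proof.
  unfold norm2; split; rewrite <- sqrt_Rsqr_abs; apply sqrt_le_1_alt; unfold Rsqr; nra.
Qed.

(** Closedness gives each point outside [S] a radius whose disk misses [S], so a gauge exists on the
    whole square [[- M, M]^2]. Then [compactness_value_2d] supplies one [d] such that every point of
    the square is covered from a point with gauge at least [d]. *)
Lemma compact_uniform_radius (S : R2 -> Prop) (Q : R -> R2 -> Prop) :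
  bounded2 S -> (forall z, closure2 S z -> S z) ->
  (forall d d' z, 0 < d' <= d -> Q d z -> Q d' z) ->
  (forall z, S z -> exists d, 0 < d /\ forall w, S w -> dist2 w z < d -> Q d w) ->
  exists d, 0 < d /\ forall w, S w -> Q d w.
Proof.
  intros [M HM] HS Hmono Hloc.
  assert (L : forall z : R2, exists d : posreal, forall w, S w ->
    Rabs (fst w - fst z) < d -> Rabs (snd w - snd z) < d -> Q d w).
  { intros z; destruct (classic (S z)) as [Hz|Hz].
    - destruct (Hloc z Hz) as [d [Hd H]].
      assert (Hd2 : 0 < d / 2) by lra.
      exists (mkposreal _ Hd2); simpl; intros w Hw H1 H2.
      apply (Hmono d); [lra|]; apply H; auto; pose proof (dist2_le_abs w z); lra.
    - assert (N : exists e, 0 < e /\ forall w, S w -> ~ dist2 w z < e).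
      { apply NNPP; intros N; apply Hz, HS; intros e He; apply NNPP; intros N'.
        apply N; exists e; split; auto; intros w Hw Hwz; apply N'; exists w; auto. }
      destruct N as [e [He H]].
      assert (He2 : 0 < e / 2) by lra.
      exists (mkposreal _ He2); simpl; intros w Hw H1 H2.
      destruct (H w Hw); pose proof (dist2_le_abs w z); lra. }
  destruct (functional_choice _ L) as [delta Hdelta].
  destruct (compactness_value_2d (- M) M (- M) M (fun x y => delta (x, y))) as [d Hd].
  exists d; split; [apply cond_pos|]; intros w Hw; apply NNPP; intros N.
  pose proof (HM w Hw) as Hn; destruct (abs_le_norm2 w) as [B1 B2].
  apply (Hd (fst w) (snd w)); [apply Rabs_le_between; lra | apply Rabs_le_between; lra |].
  intros (x & y & _ & _ & H1 & H2 & H3).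
  apply N, (Hmono (delta (x, y))); [split; [apply cond_pos | exact H3]|].
  apply (Hdelta (x, y)); auto.
Qed.

Lemma cont_on_attains_max (S : R2 -> Prop) (F : R2 -> R) :
  bounded2 S -> (forall z, closure2 S z -> S z) -> cont_on S F -> (exists z, S z) ->
  exists q, S q /\ forall z, S z -> F z <= F q.
Proof.
  intros HB HS HF [p Hp].
  (* Boundedness above: the local bound [Rabs (F z) + 1] is encoded as the inverse of a radius,
     because inverses grow as radii shrink. *)
  destruct (compact_uniform_radius S (fun d w => F w <= / d) HB HS) as [d [Hd HFd]].
  { intros d d' z [H1 H2] H; eapply Rle_trans; [exact H|]; apply Rinv_le_contravar; auto. }
  { intros z Hz; destruct (HF z Hz 1 Rlt_0_1) as [d [Hd H]].
    pose proof (Rabs_pos (F z)); pose proof (Rle_abs (F z)).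
    assert (Hi : 0 < / (Rabs (F z) + 1)) by (apply Rinv_0_lt_compat; lra).
    exists (Rmin d (/ (Rabs (F z) + 1))); split; [now apply Rmin_pos|].
    intros w Hw Hwz.
    apply Rle_trans with (Rabs (F z) + 1).
    - assert (D : Rabs (F w - F z) < 1) by (apply H; auto; eapply Rlt_le_trans; [exact Hwz | apply Rmin_l]).
      apply Rabs_def2 in D; lra.
    - rewrite <- (Rinv_inv (Rabs (F z) + 1)) at 1.
      apply Rinv_le_contravar; [now apply Rmin_pos | apply Rmin_r]. }
  destruct (completeness (fun y => exists z, S z /\ F z = y)) as [s [Hs1 Hs2]].
  { exists (/ d); intros y (z & Hz & <-); auto. }
  { exists (F p), p; auto. }
  apply NNPP; intros N.
  assert (Hlt : forall z, S z -> F z < s).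
  { intros z Hz; destruct (Rle_lt_or_eq_dec (F z) s) as [|E]; auto.
    - apply Hs1; exists z; auto.
    - destruct N; exists z; split; auto; intros w Hw; rewrite E; apply Hs1; exists w; auto. }
  (* If the supremum [s] is not attained, the gap [s - F] is locally, hence uniformly, bounded below
     by some [e > 0], and [s - e] is a smaller upper bound. *)
  destruct (compact_uniform_radius S (fun e w => F w <= s - e) HB HS) as [e [He HFe]].
  { intros; lra. }
  { intros z Hz; assert (Hg : 0 < (s - F z) / 2) by (pose proof (Hlt z Hz); lra).
    destruct (HF z Hz _ Hg) as [e [He H]].
    exists (Rmin e ((s - F z) / 2)); split; [now apply Rmin_pos|]; intros w Hw Hwz.
    assert (D : Rabs (F w - F z) < (s - F z) / 2) by (apply H; auto; eapply Rlt_le_trans; [exact Hwz | apply Rmin_l]).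
    apply Rabs_def2 in D; pose proof (Rmin_r e ((s - F z) / 2)); lra. }
  assert (s <= s - e) by (apply Hs2; intros y (z & Hz & <-); auto).
  lra.
Qed.

(** * The strong maximum principle *)

(** The function [m - f] is nonnegative with integral 0, so its primitive vanishes on [(a, b)], and
    so does the derivative of the primitive. *)
Lemma eq_max_of_RInt_max (f : R -> R) (a b m t : R) :
  (forall x, continuous f x) -> (forall x, f x <= m) -> RInt f a b = (b - a) * m ->
  a < t < b -> f t = m.
Proof.
  intros Hc Hle HI Ht.
  set (k := fun x => m - f x).
  assert (Ck : forall x, continuous k x).
  { intros x; apply (continuous_minus (V := R_NormedModule)); [apply continuous_const | auto]. }
  assert (Ek : forall x y, ex_RInt k x y) by (intros; apply (ex_RInt_continuous (V := R_CompleteNormedModule)); auto).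
  assert (E0 : RInt k a b = 0).
  { unfold k; rewrite (RInt_minus (V := R_CompleteNormedModule)), RInt_const, HI.
    - unfold minus, plus, opp, scal; simpl; unfold mult; simpl; ring.
    - apply ex_RInt_const.
    - apply (ex_RInt_continuous (V := R_CompleteNormedModule)); auto. }
  assert (F0 : forall x, a < x < b -> RInt k a x = 0).
  { intros x Hx.
    assert (P : forall p q, p <= q -> 0 <= RInt k p q).
    { intros p q Hpq; apply RInt_ge_0; auto; intros y _; unfold k; pose proof (Hle y); lra. }
    pose proof (RInt_Chasles k a x b (Ek _ _) (Ek _ _)) as Ch.
    unfold plus in Ch; simpl in Ch; rewrite E0 in Ch.
    pose proof (P a x ltac:(lra)); pose proof (P x b ltac:(lra)); lra. }
  assert (D : is_derive (fun x => RInt k a x) t (k t)).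
  { apply (is_derive_RInt k _ a); auto; exists (mkposreal 1 Rlt_0_1); intros y _.
    apply (RInt_correct (V := R_CompleteNormedModule)), Ek. }
  assert (D0 : is_derive (fun x => RInt k a x) t 0).
  { apply (is_derive_ext_loc (fun _ => 0)).
    - apply (locally_interval _ t a b); simpl; try apply Ht; intros y H1 H2; symmetry; apply F0; auto.
    - apply (is_derive_const (V := R_NormedModule)). }
  apply is_derive_unique in D, D0; rewrite D in D0; unfold k in D0; lra.
Qed.

(** The set where [w = m] is open by the mean value property, the set where [w < m] by continuity;
    connectedness forbids both to be nonempty. *)
Lemma conjugate_pair_strong_maximum U w w' m :
  is_open2 U -> connected_open U -> conjugate_pair U w w' ->
  (forall z, U z -> w z <= m) -> (exists z, U z /\ w z = m) ->
  forall z, U z -> w z = m.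
Proof.
  intros HU Hconn HC Hle Hex z Hz.
  apply NNPP; intros Hne.
  assert (Cw : cont_on U w) by (destruct HC as (? & ? & ? & ? & (_ & Cw & _) & _); exact Cw).
  apply (Hconn (fun z => U z /\ w z = m) (fun z => U z /\ w z < m)).
  - intros c [Hc Ec]; destruct (HU c Hc) as [rho [Hrho HD]].
    assert (HP : forall s t, - rho < s < rho -> U (polar c s t)).
    { intros s t Hs; apply HD; unfold disk2; rewrite dist2_polar; apply Rabs_def1; lra. }
    exists rho; split; auto; intros y Hy; split; [now apply HD|].
    (* The point [y] lies on a circle about [c] over which the mean of [w] is [m], and its angle is
       interior, so [w y = m]. *)
    destruct (polar_coordinates c y) as (s & t & Ht & -> & Es).
    assert (Hs : - rho < s < rho) by (unfold disk2 in Hy; apply Rabs_lt_between; lra).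
    apply (eq_max_of_RInt_max (fun t => w (polar c s t)) (- PI) PI); auto.
    + intros x; apply (continuous_slice (fun s t => w (polar c s t))), (cont_on_polar U); auto.
    + rewrite (conjugate_pair_circle_mean U w w' c rho), Ec by auto.
      change (2 * PI * m = (PI - - PI) * m); ring.
  - intros c [Hc Lc]; destruct (HU c Hc) as [rho [Hrho HD]].
    destruct (Cw c Hc (m - w c) ltac:(lra)) as [d [Hd Hcont]].
    exists (Rmin rho d); split; [now apply Rmin_pos|]; intros y Hy; unfold disk2 in Hy.
    assert (Uy : U y) by (apply HD; unfold disk2; eapply Rlt_le_trans; [exact Hy | apply Rmin_l]).
    split; auto.
    assert (D : Rabs (w y - w c) < m - w c) by (apply Hcont; auto; eapply Rlt_le_trans; [exact Hy | apply Rmin_r]).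
    apply Rabs_def2 in D; lra.
  - intros y Hy; destruct (Rle_lt_or_eq_dec _ _ (Hle y Hy)); auto.
  - intros y _ [_ E] [_ L]; lra.
  - destruct Hex as (y & Hy & E); exists y; auto.
  - exists z; split; auto; split; auto; pose proof (Hle z Hz); lra.
Qed.

(** Twice the inner product of the gradients at [q] and [z] is at most the sum of their squared
    norms. This makes the inner product maximal at [z = q], hence constant, and the same inequality
    then forces the squared norm at [z] up to that at [q]. *)
Lemma gradient_strong_maximum U g h q :
  is_open2 U -> connected_open U -> conjugate_pair U g h -> U q ->
  (forall z, U z -> g z ^ 2 + h z ^ 2 <= g q ^ 2 + h q ^ 2) ->
  forall z, U z -> g z ^ 2 + h z ^ 2 = g q ^ 2 + h q ^ 2.
Proof.
  intros HU Hconn HC Hq Hmax z Hz.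
  assert (E : g q * g z + h q * h z = g q ^ 2 + h q ^ 2).
  { apply (conjugate_pair_strong_maximum U (fun z => g q * g z + h q * h z)
      (fun z => g q * h z + - h q * g z)); auto.
    - now apply conjugate_pair_comb.
    - intros y Hy; cbv beta; pose proof (Hmax y Hy).
      pose proof (pow2_ge_0 (g q - g y)); pose proof (pow2_ge_0 (h q - h y)); lra.
    - exists q; split; auto; ring. }
  pose proof (Hmax z Hz).
  pose proof (pow2_ge_0 (g q - g z)); pose proof (pow2_ge_0 (h q - h z)); lra.
Qed.

(** * Comparison of the gradient inside, on the boundary and at infinity *)

Theorem mainTheorem4 (Om : R2 -> Prop) (u : R2 -> R) :
  exceptional_domain Om ->
  associated_function Om u ->
  bounded2 (compl2 Om) ->
  (forall z a b, Om z -> partial_x u z a -> partial_y u z b ->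
     sqrt (a ^ 2 + b ^ 2) < 1) /\
  (forall eps, 0 < eps -> exists M, forall z a b,
     Om z -> M < norm2 z -> partial_x u z a -> partial_y u z b ->
     sqrt (a ^ 2 + b ^ 2) < eps).
Proof.
  intros ((HU & _) & Hconn & Hunb & _) (Hharm & g & h & (_ & _ & Cg & Ch & Dgh) & Hpos & _ & Hbd) [M0 HM0].
  (* Two versions of the gradient: [g], [h] are continuous up to the boundary, while [g0], [h0] form
     a conjugate pair inside; [Hext] identifies them on [Om]. *)
  destruct (harmonic_conjugate_pair Om u HU Hharm) as (g0 & h0 & Hu & HC).
  assert (Hpart : forall z a b, Om z -> partial_x u z a -> partial_y u z b -> a = g0 z /\ b = h0 z).
  { intros z a b Hz Ha Hb; destruct (proj1 Hu z Hz) as [H1 H2]; split; eapply uniqueness_limite; eauto. }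
  assert (Hext : forall z, Om z -> g z = g0 z /\ h z = h0 z).
  { intros z Hz; destruct (Dgh z Hz); auto. }
  (* The complement lies within radius [M0]; the 1 keeps [R0] positive. *)
  set (R0 := Rmax M0 1).
  assert (HR0 : 0 < R0) by (eapply Rlt_le_trans; [apply Rlt_0_1 | apply Rmax_r]).
  assert (HE : forall z, R0 < norm2 z -> Om z).
  { intros z Hz; apply NNPP; intros N; pose proof (HM0 z N); pose proof (Rmax_l M0 1); unfold R0 in Hz; lra. }
  assert (Hlim : forall eps, 0 < eps -> exists M, R0 < M /\
    forall z, M < norm2 z -> sqrt (g0 z ^ 2 + h0 z ^ 2) < eps).
  { intros eps He; apply (exterior_gradient_vanishes Om u g0 h0 R0 eps); auto. }
  split.
  - intros p a b Hp Ha Hb; destruct (Hpart p a b Hp Ha Hb) as [-> ->]; clear Ha Hb.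
    apply Rnot_le_lt; intros Hge.
    set (G := fun z => g z ^ 2 + h z ^ 2).
    assert (EG : forall z, Om z -> G z = g0 z ^ 2 + h0 z ^ 2).
    { intros z Hz; unfold G; destruct (Hext z Hz) as [-> ->]; reflexivity. }
    assert (Gp : 1 <= G p).
    { rewrite EG by auto; apply Rnot_lt_le; intros L.
      pose proof (pow2_ge_0 (g0 p)); pose proof (pow2_ge_0 (h0 p)).
      apply (Rlt_not_le _ _ (sqrt_lt_1_alt (g0 p ^ 2 + h0 p ^ 2) 1 ltac:(lra))).
      rewrite sqrt_1; exact Hge. }
    destruct (Hlim 1 Rlt_0_1) as [M [HM HMlim]].
    assert (Gfar : forall z, M < norm2 z -> G z < 1).
    { intros z Hz; rewrite EG by (apply HE; lra); apply Rnot_le_lt; intros L.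
      apply (Rlt_not_le _ _ (HMlim z Hz)); rewrite <- sqrt_1; now apply sqrt_le_1_alt. }
    (* The closure cut off at radius [M] is compact, and beyond it [G < 1 <= G p], so a maximum
       there is a maximum over all of [Om]. *)
    assert (Hq : exists q, Om q /\ 1 <= G q /\ forall z, Om z -> G z <= G q).
    { destruct (cont_on_attains_max (fun z => closure2 Om z /\ norm2 z <= M) G) as (q & [Hq Hqn] & Hmax).
      - exists M; intros z Hz; apply Hz.
      - intros z Hz; split.
        + intros e He; destruct (Hz (e / 2)) as (y & [Hy _] & Hyz); [lra|].
          destruct (Hy (e / 2)) as (x & Hx & Hxy); [lra|].
          exists x; split; auto; pose proof (dist2_triangle x y z); lra.
        + apply Rnot_lt_le; intros L; destruct (Hz (norm2 z - M)) as (y & [_ Hy] & Hyz); [lra|].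
          pose proof (norm2_le_add_dist2 y z); lra.
      - apply (cont_on_subset _ (closure2 Om)); [intros z Hz; apply Hz|].
        assert (Sq : forall f, cont_on (closure2 Om) f -> cont_on (closure2 Om) (fun z => f z ^ 2)).
        { intros f Hf; simpl; apply cont_on_mult; auto; apply cont_on_mult; auto; apply cont_on_const. }
        apply cont_on_plus; auto.
      - exists p; split; [now apply closure2_incl|].
        apply Rnot_lt_le; intros L; pose proof (Gfar p L); lra.
      - assert (Hpq : G p <= G q).
        { apply Hmax; split; [now apply closure2_incl|].
          apply Rnot_lt_le; intros L; pose proof (Gfar p L); lra. }
        assert (Hall : forall z, Om z -> G z <= G q).
        { intros z Hz; destruct (Rle_lt_dec (norm2 z) M) as [L|L].
          - apply Hmax; split; auto; now apply closure2_incl.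
          - pose proof (Gfar z L); lra. }
        destruct (classic (Om q)) as [Hin|Hout].
        + exists q; split; [|split]; auto; lra.
        (* At a boundary maximum the value is 1, which the interior point [p] already reaches. *)
        + assert (Gq : G q = 1).
          { assert (B : boundary2 Om q).
            { split; auto; intros (e & He & Hi); apply Hout, Hi; unfold disk2; rewrite dist2_self; auto. }
            pose proof (Hbd q B) as S; unfold G.
            rewrite <- (sqrt_sqrt (g q ^ 2 + h q ^ 2)), S; [ring |].
            pose proof (pow2_ge_0 (g q)); pose proof (pow2_ge_0 (h q)); lra. }
          exists p; split; [|split]; auto; intros z Hz; pose proof (Hall z Hz); lra. }
    destruct Hq as (q & Hq & Gq & Hmax).
    (* Constancy makes [G] at least 1 on all of [Om], so no point of [Om] lies beyond radius [M],
       against unboundedness. *)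
    apply Hunb; exists M; intros z Hz; apply Rnot_lt_le; intros L.
    pose proof (Gfar z L) as F; rewrite EG in F by auto.
    rewrite (gradient_strong_maximum Om g0 h0 q) in F; auto.
    + rewrite EG in Gq by auto; lra.
    + intros y Hy; rewrite <- !EG by auto; auto.
  - intros eps He; destruct (Hlim eps He) as [M [_ HM]]; exists M.
    intros z a b Hz Hzn Ha Hb; destruct (Hpart z a b Hz Ha Hb) as [-> ->]; auto.
Qed.
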